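(* Let $r>0$, let $n\in\{1,2\}$ and let $\Omega=\{A_i : 1\le i\le n\}$ be a set of coin-flipping games (positive profits, all determined by the same coin toss) which is a basis of the convex cone $\widehat\Omega$ it generates. Then the system of least-squares prices in $\Omega$ is minimal among arbitrage-free price systems. That is: if $R_i>0$ $(1\le i\le n)$ are prices of the games $A_i$ such that $R_i\le u_r^{A_i,\Omega}$ for all $1\le i\le n$ and $R_k<u_r^{A_k,\Omega}$ for some $k$, then the price system assigning to each mixed game $\sum_i k_iA_i$ $(k_i\geq 0)$ the price $\sum_i k_iR_i$ is not arbitrage-free: there exists a nonzero mixed game $M=\sum_{i=1}^n q_iA_i$ with $q_i\ge0$ such that, at the price $R=\sum_{i=1}^n q_iR_i$, the limit expectation of its growth rate satisfies $G^{M}_{R}>e^{r}$.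
   Context: Games. A coin-flipping game $A=(a,b)$, $a,b>0$, pays profit $a$ if a tossed fair coin yields heads and $b$ if it yields tails. All games considered depend on the same coin toss (they are completely correlated), so games are added and multiplied by nonnegative scalars as vectors in $\mathbb{R}^2$. Put $E^A:=(a+b)/2$. Growth rate and price. Suppose game $A=(a,b)$ is offered at price $u>0$, and let $t\in[0,1]$. The investor starts with capital $1$ and repeatedly invests the fraction $t$ of the current capital in independent plays: current capital $c$ becomes $act/u+c(1-t)$ with probability $1/2$ (heads) and $bct/u+c(1-t)$ with probability $1/2$ (tails). Let $c_N$ be the capital after $N$ plays. $G_u^A$ (the limit expectation of the growth rate) denotes the maximum over $t\in[0,1]$ of $\lim_{N\to\infty}\mathbb{E}[c_N^{1/N}]$. For the risk-free continuously compounded interest rate $r>0$, the price $u_r^A$ is the value $u>0$ determined by $G_u^A=e^r$. (One has $0<u_r^A\le E^A/e^r$ and $u_r^{kA}=k u_r^A$ for $k>0$.) Cone and basis. $\widehat\Omega:=\{\sum_{i=1}^n k_iA_i : k_i\ge 0\}$; its elements are called mixed games. $\Omega=\{A_i:1\le i\le n\}$ being a basis means that $\sum_i k_iA_i=\sum_i k_i'A_i$ with $k_i,k_i'\ge0$ implies $k_i=k_i'$ for all $i$. Least-squares prices. Let $S:=\{(t_i)\in\mathbb{R}^n : 0\le t_i\le 1\}$ and $Q:=\{(p_i)\in\mathbb{R}^n : \sum_i p_i=1,\ p_i\ge 0\}$. For $(t_i)\in S$ define $$L((t_i)):=\sup_{(p_i)\in Q}\frac{u_r^{\sum_{i=1}^n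 p_iA_i}}{\sum_{i=1}^n p_i\bigl(u_r^{A_i}+t_i(E^{A_i}/e^r-u_r^{A_i})\bigr)}.$$ The set $T:=\{(t_i)\in S: L((t_i))\le 1\}$ is nonempty, convex and compact, so there is a unique point $(x_i)\in T$ minimizing $\sum_i t_i^2$ over $T$. The least-squares price of $A_i$ in $\Omega$ is $u_r^{A_i,\Omega}:=u_r^{A_i}+x_i(E^{A_i}/e^r-u_r^{A_i})$, and for a mixed game $\sum_i k_iA_i\in\widehat\Omega$ one defines $u_r^{\sum_i k_iA_i,\,\Omega}:=\sum_i k_i u_r^{A_i,\Omega}$. Arbitrage-free. A system of prices is arbitrage-free if no investor has an opportunity to earn a profit exceeding the risk-free interest rate, i.e. no nonzero mixed game, at its price, has limit expectation of the growth rate exceeding $e^r$. *)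

(* Defs.v *)
From HB Require Import structures.
From mathcomp Require Import all_boot all_order all_algebra.
From mathcomp Require Import all_classical all_reals all_analysis.

Set Implicit Arguments.
Unset Strict Implicit.
Unset Printing Implicit Defensive.

Import Order.TTheory GRing.Theory Num.Theory.
Import numFieldNormedType.Exports.
Local Open Scope classical_set_scope.
Local Open Scope ring_scope.

Section CoinFlippingGames.
Context {R : realType}.

(* The game (a, b) pays a on heads and b on tails. *)
Definition coin_game (A : R * R) : Prop := 0 < A.1 /\ 0 < A.2.

Definition game_mean (A : R * R) : R := (A.1 + A.2) / 2.

(* The toss [true] is heads. *)
Definition play (A : R * R) (u t c : R) (heads : bool) : R :=
  (if heads then A.1 else A.2) * c * t / u + c * (1 - t).

Definition capital (A : R * R) (u t : R) (w : seq bool) : R :=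
  foldl (play A u t) 1 w.

(* E[c_N^(1/N)]: the 2^N outcomes of N independent fair tosses are
   equiprobable. *)
Definition expected_growth (A : R * R) (u t : R) (N : nat) : R :=
  (\sum_(w : N.-tuple bool) capital A u t w `^ (N%:R^-1)) / 2 ^+ N.

(* For u > 0 and A in the positive cone the limit exists, depends
   continuously on t and hence attains its supremum: [sup] is a maximum. *)
Definition growth_rate (A : R * R) (u : R) : R :=
  sup [set limn (expected_growth A u t) | t in `[0, 1]].

Definition price (r : R) (A : R * R) : R :=
  get [set u : R | 0 < u /\ growth_rate A u = expR r].

Variable n : nat.
Implicit Types (A : 'I_n -> R * R) (k p t : 'I_n -> R).

Definition mixed_game A k : R * R := \sum_(i < n) k i *: A i.

Definition cone_basis A : Prop :=
  forall k k', (forall i, 0 <= k i) -> (forall i, 0 <= k' i) ->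
    mixed_game A k = mixed_game A k' -> forall i, k i = k' i.

Definition unit_cube : set ('I_n -> R) := [set t | forall i, 0 <= t i <= 1].

Definition prob_simplex : set ('I_n -> R) :=
  [set p | \sum_(i < n) p i = 1 /\ forall i, 0 <= p i].

Definition interp_price (r : R) A t (i : 'I_n) : R :=
  price r (A i) + t i * (game_mean (A i) / expR r - price r (A i)).

Definition lsq_sup (r : R) A t : \bar R :=
  ereal_sup [set (price r (mixed_game A p)
                   / \sum_(i < n) p i * interp_price r A t i)%:E
            | p in prob_simplex].

Definition lsq_feasible (r : R) A : set ('I_n -> R) :=
  [set t | unit_cube t /\ (lsq_sup r A t <= 1)%E].

Definition lsq_point (r : R) A : 'I_n -> R :=
  get [set x | lsq_feasible r A x /\
    forall t, lsq_feasible r A t ->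
      \sum_(i < n) x i ^+ 2 <= \sum_(i < n) t i ^+ 2].

Definition lsq_price (r : R) A (i : 'I_n) : R :=
  interp_price r A (lsq_point r A) i.

End CoinFlippingGames.

(* Main.v *)
(* By a power mean argument, investing the fraction [t] at price [u] has limit
   growth [sqrt (x y)], where [x] and [y] are the payoff factors of heads and
   tails. If lower prices [P] left no mixed game with growth rate above [e^r],
   then every mixed game would cost at least its price [u_r], so that
   [P_i = u_r^(A_i) + t_i (E^(A_i) / e^r - u_r^(A_i))] for a point [t] of the
   feasible set with [0 <= t_i <= x_i] for all [i] and [t_k < x_k] for some [k];
   its norm would be smaller than that of the least-squares point [x]. *)
Require Import Defs.
From mathcomp Require Import all_boot all_order all_algebra.
From mathcomp Require Import all_classical all_reals all_analysis.
From mathcomp Require Import ring lra.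
Import Order.TTheory GRing.Theory Num.Theory.
Import numFieldNormedType.Exports.
Local Open Scope ring_scope.

(** * Growth rate as a function of the invested fraction and of the price *)

Section Growth.
Local Open Scope classical_set_scope.
Context {R : realType}.
Implicit Types (A : R * R) (a u v t x y r : R).

Definition payoff (a u t : R) : R := a * t / u + (1 - t).

Lemma playE A u t c (b : bool) :
  play A u t c b = c * payoff (if b then A.1 else A.2) u t.
Proof. by rewrite /play /payoff; case: b; ring. Qed.

Lemma payoff_gt0 {a u t} : 0 < a -> 0 < u -> 0 <= t <= 1 -> 0 < payoff a u t.
Proof.
move=> a0 u0 /andP[t0 t1]; rewrite /payoff.
have [->|tN1] := eqVneq t 1; first by rewrite mulr1 subrr addr0 divr_gt0.
rewrite ltr_wpDl ?subr_gt0 ?lt_neqAle ?tN1//.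
by rewrite divr_ge0 ?mulr_ge0// ltW.
Qed.

(** Each toss multiplies the capital by one of two factors, so the sum over all words is an expanded
    product. The starting capital [c] is general because the induction peels off the first toss,
    which turns [c] into another starting capital. *)
Lemma sum_foldl_play_powR A u t c s N : 0 <= c ->
  0 <= payoff A.1 u t -> 0 <= payoff A.2 u t ->
  \sum_(w : N.-tuple bool) foldl (play A u t) c w `^ s =
  c `^ s * (payoff A.1 u t `^ s + payoff A.2 u t `^ s) ^+ N.
Proof.
move=> c0 x0 y0; elim: N c c0 => [|N IHN] c c0.
  rewrite (eq_bigr (fun=> c `^ s)); last by move=> w _; rewrite tuple0.
  by rewrite sumr_const card_tuple expn0 mulr1n expr0 mulr1.
rewrite (reindex (fun p : bool * N.-tuple bool => [tuple of p.1 :: p.2]))/=.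
  rewrite -(pair_bigA _ (fun b (w : N.-tuple bool) =>
    foldl (play A u t) (play A u t c b) w `^ s))/= big_bool/= !playE/=.
  by rewrite !IHN ?mulr_ge0// !powRM// exprS; ring.
exists (fun w => (thead w, [tuple of behead w])) => [[b w] _|w _]/=.
  by congr pair; apply: val_inj.
by rewrite -tuple_eta.
Qed.

Lemma expected_growthE A u t N :
  0 < payoff A.1 u t -> 0 < payoff A.2 u t ->
  expected_growth A u t N =
  ((payoff A.1 u t `^ N%:R^-1 + payoff A.2 u t `^ N%:R^-1) / 2) ^+ N.
Proof.
move=> x0 y0.
rewrite /expected_growth /capital sum_foldl_play_powR ?ltW//.
by rewrite powR1 mul1r expr_div_n.
Qed.

(* With [h = 1 / N], the logarithm of the sequence is [phi h / h], where [phi]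
   vanishes at [0] and has derivative [(ln x + ln y) / 2] there. *)
Lemma cvg_power_mean x y : 0 < x -> 0 < y ->
  (((x `^ N%:R^-1 + y `^ N%:R^-1) / 2) ^+ N @[N --> \oo] --> Num.sqrt (x * y)).
Proof.
move=> x0 y0.
pose phi (h : R) := ln ((expR (h * ln x) + expR (h * ln y)) / 2).
have phi0 : phi 0 = 0.
  by rewrite /phi !mul0r expR0 -mulr2n -mulr_natr mul1r divff// ln1.
have dphi : is_derive (0 : R) 1 phi ((ln x + ln y) / 2).
  have d (z : R) : is_derive (0 : R) 1 (fun h => expR (h * z)) z.
    have dl : is_derive (0 : R) 1 (fun h : R => h * z) z.
      by apply: is_derive_eq; rewrite scaler0 add0r [_ *: _]mulr1.
    have := @is_derive1_comp _ expR (fun h => h * z) 0 _ _ (is_derive_expR _) dl.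
    by rewrite mul0r expR0 mul1r.
  have dm : is_derive (0 : R) 1
      (fun h => (expR (h * ln x) + expR (h * ln y)) / 2) ((ln x + ln y) / 2).
    apply: is_derive_eq.
    by rewrite /GRing.scale/= !mulr0 add0r mulrC.
  have l1 : is_derive ((expR (0 * ln x) + expR (0 * ln y)) / 2 : R) 1 (@ln R) 1.
    apply: is_derive_eq.
      by apply: is_derive1_ln; rewrite divr_gt0 ?addr_gt0 ?expR_gt0.
    by rewrite !mul0r expR0 -mulr2n -mulr_natr mul1r divff// invr1.
  by have := @is_derive1_comp _ (@ln R)
    (fun h => (expR (h * ln x) + expR (h * ln y)) / 2) 0 _ _ l1 dm; rewrite mul1r.
(* The shift makes every [h = 1 / (N + 1)] nonzero, as the punctured limit of the difference
   quotient demands. *)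
rewrite -cvg_shiftS/=.
have -> : Num.sqrt (x * y) = expR ((ln x + ln y) / 2).
  by rewrite -lnM ?posrE// expRM lnK ?posrE ?mulr_gt0// powR12_sqrt// mulr_ge0// ltW.
have -> : (fun N => ((x `^ N.+1%:R^-1 + y `^ N.+1%:R^-1) / 2) ^+ N.+1)
    = (fun N => expR (N.+1%:R * phi N.+1%:R^-1)).
  apply/funext => N.
  rewrite [in RHS]mulrC expRM /phi lnK ?posrE ?divr_gt0 ?addr_gt0 ?expR_gt0//.
  rewrite powR_mulrn ?divr_ge0 ?addr_ge0 ?expR_ge0//.
  by rewrite /powR !gt_eqF.
apply: continuous_cvg; first exact: continuous_expR.
have cphi : cvg ((fun h : R => h^-1 *: ((phi \o shift 0) (h *: 1) - phi 0)) @ 0^').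
  exact: (@ex_derive _ _ _ _ _ _ _ dphi).
rewrite -(@derive_val _ _ _ _ _ _ _ dphi).
move/cvgr_dnbhsP : cphi => /(_ (fun N => N.+1%:R^-1)) H.
apply: cvg_trans (H _); last first.
  by split; [move=> N; rewrite invr_neq0|exact: cvg_harmonic].
apply: near_eq_cvg; near=> N => /=.
by rewrite invrK phi0 subr0 addr0 [_ *: 1]mulr1.
Unshelve. all: by end_near.
Qed.


Definition geometric_growth A u t := Num.sqrt (payoff A.1 u t * payoff A.2 u t).

Lemma lim_expected_growth A u t : coin_game A -> 0 < u -> 0 <= t <= 1 ->
  limn (expected_growth A u t) = geometric_growth A u t.
Proof.
move=> [a0 b0] u0 t01.
have x0 := payoff_gt0 a0 u0 t01; have y0 := payoff_gt0 b0 u0 t01.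
rewrite (funext (fun N => @expected_growthE A u t N x0 y0)).
by apply: cvg_lim; [exact: Rhausdorff|exact: cvg_power_mean].
Qed.

Lemma growth_rate_attained A u : coin_game A -> 0 < u ->
  exists t, [/\ 0 <= t <= 1, growth_rate A u = geometric_growth A u t
    & forall s, 0 <= s <= 1 -> geometric_growth A u s <= growth_rate A u].
Proof.
move=> gA u0.
have cont : {within `[0, 1], continuous (geometric_growth A u)}.
  apply: continuous_subspaceT => t.
  have cp a : {for t, continuous (payoff a u)}.
    rewrite /payoff; apply: cvgD; last first.
      by apply: cvgB; [exact: cvg_cst|exact: cvg_id].
    by apply: cvgM; last exact: cvg_cst; apply: cvgM; [exact: cvg_cst|exact: cvg_id].
  by apply: continuous_comp; [apply: cvgM; exact: cp|exact: sqrt_continuous].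
have [c c01 cmax] := EVT_max ler01 cont.
have eqG : growth_rate A u = geometric_growth A u c.
  rewrite /growth_rate; apply/le_anti/andP; split.
    apply: ge_sup.
      exists (limn (expected_growth A u 0)), 0 => //.
      by rewrite /= in_itv/= lexx ler01.
    move=> _ [t t01 <-]; rewrite lim_expected_growth//.
    exact: cmax.
  apply: ub_le_sup; last by exists c => //; rewrite lim_expected_growth.
  exists (geometric_growth A u c) => _ [t t01 <-].
  by rewrite lim_expected_growth//; exact: cmax.
by exists c; split=> // s s01; rewrite eqG; apply: cmax; rewrite in_itv.
Qed.

(** AM-GM: the right-hand side is the arithmetic mean of the two payoff factors. *)
Lemma geometric_growth_le_mean A u t : coin_game A -> 0 < u -> 0 <= t <= 1 ->
  geometric_growth A u t <= 1 + t * (game_mean A / u - 1).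
Proof.
move=> [a0 b0] u0 t01.
have x0 := payoff_gt0 a0 u0 t01; have y0 := payoff_gt0 b0 u0 t01.
have -> : 1 + t * (game_mean A / u - 1) = (payoff A.1 u t + payoff A.2 u t) / 2.
  by rewrite /payoff /game_mean; field; rewrite gt_eqF.
have h0 : 0 <= (payoff A.1 u t + payoff A.2 u t) / 2 by lra.
rewrite -(ger0_norm h0) -sqrtr_sqr /geometric_growth ler_sqrt ?sqr_ge0//.
have := sqr_ge0 (payoff A.1 u t - payoff A.2 u t).
nra.
Qed.

Lemma payoff_le_scale {a u v t} : 0 < a -> 0 < u -> u <= v -> 0 <= t <= 1 ->
  payoff a v t <= payoff a u t <= v / u * payoff a v t.
Proof.
move=> a0 u0 uv /andP[t0 t1]; have v0 := lt_le_trans u0 uv.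
rewrite /payoff; apply/andP; split.
  by rewrite lerD2r ler_wpM2l ?mulr_ge0 ?(ltW a0)// lef_pV2.
rewrite mulrDr; have -> : v / u * (a * t / v) = a * t / u.
  by field; rewrite !gt_eqF.
by rewrite lerD2l ler_peMl ?subr_ge0// ler_pdivlMr// mul1r.
Qed.

(** The fraction that is optimal at [u] remains available at [v], where each payoff factor shrinks
    by at most [v / u], since the uninvested part is unaffected. In [exists_price] this bound does
    the work of continuity in the price. *)
Lemma growth_rate_le_scale A u v : coin_game A -> 0 < u -> u <= v ->
  growth_rate A u <= v / u * growth_rate A v.
Proof.
move=> gA u0 uv; have v0 := lt_le_trans u0 uv.
have [t [t01 -> _]] := growth_rate_attained _ _ gA u0.
have [_ [_ _ /(_ _ t01)]] := growth_rate_attained _ _ gA v0.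
have vu0 : 0 <= v / u by rewrite divr_ge0 ?ltW.
move/(ler_wpM2l vu0); apply: le_trans.
case: (gA) => a0 b0.
have /andP[_ ha] := payoff_le_scale a0 u0 uv t01.
have /andP[_ hb] := payoff_le_scale b0 u0 uv t01.
have xv := ltW (payoff_gt0 a0 v0 t01); have yv := ltW (payoff_gt0 b0 v0 t01).
have xu := ltW (payoff_gt0 a0 u0 t01); have yu := ltW (payoff_gt0 b0 u0 t01).
rewrite /geometric_growth -[X in X * Num.sqrt _](ger0_norm vu0).
rewrite -sqrtr_sqr -sqrtrM ?sqr_ge0//.
rewrite ler_sqrt; last by rewrite mulr_ge0 ?sqr_ge0 ?mulr_ge0.
by rewrite expr2 mulrACA; exact: ler_pM.
Qed.

(* The optimal fraction at the higher price is positive since its growth rate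
   exceeds [1], so investing the same fraction at the lower price strictly helps. *)
Lemma growth_rate_lt A u v : coin_game A -> 0 < u -> u < v ->
  1 < growth_rate A v -> growth_rate A v < growth_rate A u.
Proof.
move=> gA u0 uv; have v0 := lt_trans u0 uv.
have [t [t01 -> _]] := growth_rate_attained _ _ gA v0.
have [_ [_ _ /(_ _ t01) le_u]] := growth_rate_attained _ _ gA u0.
move=> g1; apply: lt_le_trans le_u.
have t0 : 0 < t.
  case/andP: (t01) => t0 _; rewrite lt_neqAle t0 andbT; apply/eqP => te.
  move: g1; rewrite -te /geometric_growth /payoff !mulr0 !mul0r subr0 !add0r.
    by rewrite mulr1 sqrtr1 ltxx.
have lt_payoff a : 0 < a -> payoff a v t < payoff a u t.
  by move=> a0; rewrite /payoff ltrD2r ltr_pM2l ?mulr_gt0// ltf_pV2.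
case: gA => a0 b0; rewrite /geometric_growth ltr_sqrt ?mulr_gt0 ?payoff_gt0//.
by apply: ltr_pM; rewrite ?lt_payoff// ltW// payoff_gt0.
Qed.

(** The bound [1 + t * (m - 1)], with [m] the mean over the price, can exceed 1 only if [m] does,
    and is then largest at [t = 1]. *)
Lemma growth_rate_gt1_le_mean A u : coin_game A -> 0 < u -> 1 < growth_rate A u ->
  growth_rate A u <= game_mean A / u.
Proof.
move=> gA u0; have [t [/andP[t0 t1] eqG _]] := growth_rate_attained _ _ gA u0.
have := geometric_growth_le_mean A u t gA u0; rewrite t0 t1 -eqG => /(_ isT) leG G1.
by set m := _ / u in leG *; have [m1|m1] := leP m 1; nra.
Qed.

(** The price is the supremum of all [u] with growth at least [e^r]; the scaling bound excludes a
    growth above or below [e^r] there. *)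
Lemma exists_price r A : 0 < r -> coin_game A ->
  exists u, 0 < u /\ growth_rate A u = expR r.
Proof.
move=> r0 gA; have e1 : 1 < expR r by rewrite expR_gt1.
have e0 := lt_trans ltr01 e1.
pose S := [set u : R | 0 < u /\ expR r <= growth_rate A u].
have Sm : ubound S (game_mean A).
  move=> u [u0 le_e]; have G1 := lt_le_trans e1 le_e.
  have := le_trans (ltW G1) (growth_rate_gt1_le_mean _ _ gA u0 G1).
  by rewrite ler_pdivlMr// mul1r.
have S0 : S !=set0.
  (* At the price [m / expR r], investing everything multiplies the capital by at least [e^r] on
     either outcome. *)
  case: (gA) => a0 b0; set m := Num.min A.1 A.2.
  have m0 : 0 < m by rewrite lt_min a0.
  have u0 : 0 < m / expR r by rewrite divr_gt0.
  exists (m / expR r); split=> //.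
  have [_ [_ _ /(_ 1)]] := growth_rate_attained _ _ gA u0.
  rewrite ler01 lexx => /(_ isT); apply: le_trans.
  rewrite /geometric_growth /payoff !mulr1 subrr !addr0.
  have le_ratio a : m <= a -> expR r <= a / (m / expR r).
    by move=> ma; rewrite ler_pdivlMr// mulrCA divff ?mulr1// gt_eqF.
  have le_a : expR r <= A.1 / (m / expR r) by apply: le_ratio; rewrite ge_min lexx.
  have le_b : expR r <= A.2 / (m / expR r).
    by apply: le_ratio; rewrite ge_min lexx orbT.
  have le_ab := ler_pM (ltW e0) (ltW e0) le_a le_b.
  have ee0 : 0 <= expR r * expR r by rewrite mulr_ge0 ?ltW.
  rewrite -[leLHS](ger0_norm (ltW e0)) -sqrtr_sqr ler_sqrt.
    by rewrite expr2.
  exact: le_trans ee0 le_ab.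
have hS : has_sup S by split=> //; exists (game_mean A).
set s := sup S.
have s0 : 0 < s.
  by case: S0 => u uS; apply: lt_le_trans (ub_le_sup hS.2 uS); case: uS.
exists s; split=> //; apply/le_anti/andP; split; rewrite leNgt; apply/negP => lt_s.
- have Gs0 := lt_trans e0 lt_s.
  (* Raising the price by the factor by which growth exceeds [e^r] keeps growth at least [e^r], so
     [v] lies in [S] beyond its supremum. *)
  set v := s * (growth_rate A s / expR r).
  have sv : s < v by rewrite /v ltr_pMr// ltr_pdivlMr// mul1r.
  have v0 := lt_trans s0 sv.
  suff /(ub_le_sup hS.2) : S v by rewrite leNgt sv.
  split; first exact: v0.
  have := growth_rate_le_scale _ _ _ gA s0 (ltW sv).
  have -> : v / s = growth_rate A s / expR r by rewrite /v; field; rewrite !gt_eqF.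
  by rewrite mulrAC -mulrA (ler_pMr _ Gs0) (ler_pdivlMr _ _ e0) mul1r; apply.
(* The margin puts some [u] of [S] above [s * growth_rate A s / expR r], whereas the scaling bound
   keeps all of [S] at or below this value. *)
- have e_pos : 0 < s - s * (growth_rate A s / expR r).
    by rewrite subr_gt0 gtr_pMr// ltr_pdivrMr// mul1r.
  have [u uS] := sup_adherent e_pos hS.
  rewrite -/s subKr mulrA ltr_pdivrMr// => lt_u.
  have us : u <= s := ub_le_sup hS.2 uS.
  case: uS => u0 e_le; have := le_trans e_le (growth_rate_le_scale _ _ _ gA u0 us).
  by rewrite mulrAC ler_pdivlMr// mulrC leNgt lt_u.
Qed.

End Growth.

(** * The price as a threshold for the growth rate *)

Section Price.
Context {R : realType}.
Implicit Types (A : R * R) (r u : R).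

Lemma priceP r A : 0 < r -> coin_game A ->
  0 < price r A /\ growth_rate A (price r A) = expR r.
Proof. by move=> r0 gA; exact: getPex (exists_price _ _ r0 gA). Qed.

(** Contrapositive of strict monotonicity, available because growth at the price is [e^r > 1]. It
    turns absence of arbitrage into a lower bound on what a game costs. *)
Lemma price_le r A u : 0 < r -> coin_game A -> 0 < u ->
  growth_rate A u <= expR r -> price r A <= u.
Proof.
move=> r0 gA u0; have [p0 Gp] := priceP _ _ r0 gA.
rewrite !leNgt; apply: contra => ltu.
rewrite -Gp; apply: growth_rate_lt => //.
by rewrite Gp expR_gt1.
Qed.

Lemma price_le_mean r A : 0 < r -> coin_game A ->
  price r A <= game_mean A / expR r.
Proof.
move=> r0 gA; have [p0 Gp] := priceP _ _ r0 gA.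
have := growth_rate_gt1_le_mean _ _ gA p0; rewrite Gp expR_gt1 => /(_ r0).
by rewrite (ler_pdivlMr _ _ p0) (ler_pdivlMr _ _ (expR_gt0 r)) mulrC; apply.
Qed.

End Price.

(** * The least-squares point and its minimality *)

Section LeastSquares.
Local Open Scope classical_set_scope.
Context {R : realType} {n : nat}.
Implicit Types (A : 'I_n -> R * R) (p t x P : 'I_n -> R) (r : R).

Lemma simplex_sum_gt0 p x : prob_simplex p -> (forall i, 0 < x i) ->
  0 < \sum_(i < n) p i * x i.
Proof.
move=> [p1 p0] x0.
have px0 i : true -> 0 <= p i * x i by move=> _; rewrite mulr_ge0// ltW.
rewrite lt_neqAle sumr_ge0// andbT; apply/eqP => /esym /(psumr_eq0P px0) px.
move: p1; rewrite big1 => [/eqP|i _]; first by rewrite eq_sym oner_eq0.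
by apply/eqP; move/eqP: (px i isT); rewrite mulf_eq0 (gt_eqF (x0 i)) orbF.
Qed.

Lemma mixed_game1 A p : (mixed_game A p).1 = \sum_(i < n) p i * (A i).1.
Proof. by rewrite /mixed_game (big_morph fst (id1 := 0) (op1 := +%R)). Qed.

Lemma mixed_game2 A p : (mixed_game A p).2 = \sum_(i < n) p i * (A i).2.
Proof. by rewrite /mixed_game (big_morph snd (id1 := 0) (op1 := +%R)). Qed.

Lemma coin_game_mixed A p : (forall i, coin_game (A i)) -> prob_simplex p ->
  coin_game (mixed_game A p).
Proof.
move=> gA pS; rewrite /coin_game mixed_game1 mixed_game2.
by split; apply: simplex_sum_gt0 => // i; case: (gA i).
Qed.

Lemma game_mean_mixed A p :
  game_mean (mixed_game A p) = \sum_(i < n) p i * game_mean (A i).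
Proof.
rewrite /game_mean mixed_game1 mixed_game2 -big_split mulr_suml.
by apply: eq_bigr => i _ /=; rewrite -mulrDr mulrA.
Qed.

Lemma interp_price_gt0 r A t i : 0 < r -> coin_game (A i) -> unit_cube t ->
  0 < interp_price r A t i.
Proof.
move=> r0 gA /(_ i)/andP[t0 _]; have [p0 _] := priceP _ _ r0 gA.
by rewrite /interp_price ltr_pwDl// mulr_ge0// subr_ge0 price_le_mean.
Qed.

(** The denominators are positive, so clearing them turns the bound on the supremum into a family of
    inequalities affine in [t]. *)
Lemma lsq_feasibleE r A : 0 < r -> (forall i, coin_game (A i)) ->
  lsq_feasible r A = @unit_cube R n `&`
    \bigcap_(p in @prob_simplex R n) [set t |
      price r (mixed_game A p) <= \sum_(i < n) p i * interp_price r A t i].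
Proof.
move=> r0 gA; apply/seteqP; split=> t [tC].
  move=> le1; split=> // p pS /=.
  have s0 := simplex_sum_gt0 p _ pS (fun i => interp_price_gt0 _ _ _ i r0 (gA i) tC).
  rewrite -[leRHS]mul1r -ler_pdivrMr// -lee_fin; apply: le_trans le1.
  by apply: ereal_sup_ubound; exists p.
move=> H; split=> //; apply: ge_ereal_sup => _ [p pS <-].
have s0 := simplex_sum_gt0 p _ pS (fun i => interp_price_gt0 _ _ _ i r0 (gA i) tC).
by rewrite lee_fin ler_pdivrMr// mul1r; exact: H.
Qed.

(** At this vertex the prices are the discounted means, which are linear in the mixture and dominate
    its price. Hence the feasible set is nonempty. *)
Lemma lsq_feasible1 r A : 0 < r -> (forall i, coin_game (A i)) ->
  lsq_feasible r A (fun=> 1).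
Proof.
move=> r0 gA; rewrite lsq_feasibleE//; split=> [i|p pS /=].
  by rewrite ler01 lexx.
under eq_bigr do rewrite /interp_price mul1r addrC subrK mulrA.
rewrite -mulr_suml -game_mean_mixed; apply: price_le_mean => //.
exact: coin_game_mixed.
Qed.

(* Row vectors carry the product topology needed for the extreme value
   theorem. *)
Lemma lsq_feasible_compact r A : 0 < r -> (forall i, coin_game (A i)) ->
  compact [set v : 'rV[R]_n | lsq_feasible r A (v ord0)].
Proof.
move=> r0 gA; rewrite lsq_feasibleE//.
(* A compact box is cut by closed half-spaces, one for each mixture [p]. *)
have -> : [set v : 'rV[R]_n | (@unit_cube R n `&` \bigcap_(p in @prob_simplex R n) [set t |
      price r (mixed_game A p) <= \sum_(i < n) p i * interp_price r A t i]) (v ord0)]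
  = [set v : 'rV[R]_n | forall i, `[0, 1] (v ord0 i)] `&`
    \bigcap_(p in @prob_simplex R n)
      ((fun v : 'rV[R]_n => \sum_(i < n) p i * interp_price r A (v ord0) i) @^-1`
       [set y | price r (mixed_game A p) <= y]).
  apply/seteqP; split=> v [vC vS]; split=> // i; have := vC i; rewrite /= in_itv//.
apply: compact_closedI.
  by apply: (@rV_compact R n (fun=> `[0, 1])) => i; exact: segment_compact.
apply: closed_bigI => p pS; apply: preimage_closed; last exact: closed_ge.
move=> v _; apply: (cvg_big (F := nbhs v) add_continuous) => i _.
apply: cvgM; first exact: cvg_cst.
apply: cvgD; first exact: cvg_cst.
by apply: cvgM; [exact: coord_continuous|exact: cvg_cst].
Qed.

(** A continuous function attains its minimum on a nonempty compact set, so the [get] in [lsq_point]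
    returns a minimizer and not a default value. *)
Lemma lsq_pointP r A : 0 < r -> (forall i, coin_game (A i)) ->
  lsq_feasible r A (lsq_point r A) /\
  forall t, lsq_feasible r A t ->
    \sum_(i < n) lsq_point r A i ^+ 2 <= \sum_(i < n) t i ^+ 2.
Proof.
move=> r0 gA; apply: (@getPex _ [set x | lsq_feasible r A x /\
    forall t, lsq_feasible r A t ->
      \sum_(i < n) x i ^+ 2 <= \sum_(i < n) t i ^+ 2]).
have rowK t : (\row_i t i) ord0 = t by apply/funext => i; rewrite mxE.
have [||c] := EVT_min_rV (f := fun v : 'rV[R]_n => \sum_(i < n) v ord0 i ^+ 2)
  _ (lsq_feasible_compact _ _ r0 gA).
- by exists (\row_i 1); rewrite /= rowK; exact: lsq_feasible1.
- apply: continuous_subspaceT => v.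
  apply: (cvg_big (F := nbhs v) add_continuous) => i _.
  by apply: cvgM; exact: coord_continuous.
rewrite inE /= => cF cmin; exists (c ord0); split=> // t tF.
by have := cmin (\row_i t i); rewrite inE /= rowK; apply.
Qed.

Lemma lsq_price_minimal r A P : 0 < r -> (forall i, coin_game (A i)) ->
  (forall i, P i <= lsq_price r A i) -> (exists k, P k < lsq_price r A k) ->
  exists2 p, prob_simplex p &
    \sum_(i < n) p i * P i < price r (mixed_game A p).
Proof.
move=> r0 gA leP [k ltP]; apply: contrapT => noarb.
have arb_free p : prob_simplex p ->
    price r (mixed_game A p) <= \sum_(i < n) p i * P i.
  by move=> pS; rewrite leNgt; apply/negP => lt_p; apply: noarb; exists p.
have [xF xmin] := lsq_pointP r A r0 gA; set x := lsq_point r A in xF xmin.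
have xC := xF.1.
have price_leP i : price r (A i) <= P i.
  (* The vertices of the simplex give the games [A i] themselves. *)
  have dS : prob_simplex (fun j => (j == i)%:R : R).
    split=> [|j]; last exact: ler0n.
    by rewrite (bigD1 i)//= eqxx big1 ?addr0// => j /negPf ->.
  have pick (V : lmodType R) (F : 'I_n -> V) : \sum_(j < n) (j == i)%:R *: F j = F i.
    rewrite (bigD1 i)//= eqxx scale1r big1 ?addr0// => j /negPf ->.
    by rewrite scale0r.
  have := arb_free _ dS.
  by rewrite /mixed_game (pick _ A) (pick R^o P).
pose d i := game_mean (A i) / expR r - price r (A i).
have d0 i : 0 <= d i by rewrite subr_ge0 price_le_mean.
pose t i := (P i - price r (A i)) / d i.
have tx i : [/\ 0 <= t i, t i <= x i & interp_price r A t i = P i].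
  have /andP[x0 _] := xC i.
  have := leP i; rewrite /lsq_price /interp_price -/x -/(d i) /t.
  (* If [d i = 0], division by zero gives [t i = 0]. The least-squares price then equals
     [price r (A i)], which squeezes [P i] to the same value. *)
  have [->|dN0] := eqVneq (d i) 0.
    rewrite invr0 !mulr0 addr0 => le_p; split=> //.
    by apply/le_anti; rewrite price_leP.
  have dp : 0 < d i by rewrite lt_neqAle eq_sym dN0 d0.
  rewrite -lerBlDl => le_x; split.
  - by rewrite divr_ge0// subr_ge0.
  - by rewrite ler_pdivrMr.
  - by rewrite divfK// addrC subrK.
have tF : lsq_feasible r A t.
  rewrite lsq_feasibleE//; split=> [i|p pS /=].
    have [t0 tle _] := tx i; have /andP[_ x1] := xC i.
    by rewrite t0 (le_trans tle).
  by under eq_bigr => i _ do have [_ _ ->] := tx i; exact: arb_free.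
have tk : t k < x k.
  have [_ tle tP] := tx k; rewrite lt_neqAle tle andbT; apply/eqP => tk.
  by move: ltP; rewrite -tP /lsq_price /interp_price -/x tk ltxx.
have := xmin t tF; apply/negP; rewrite -ltNge.
(* As [t] is nonnegative, squaring preserves the comparison with [x], strictly at [k]. *)
rewrite (bigD1 k)//= [ltRHS](bigD1 k)//= ltr_leD//.
  have [t0 _ _] := tx k.
  by rewrite ltrXn2r// ?nnegrE// (le_trans t0)// ltW.
apply: ler_sum => i _; have [t0 tle _] := tx i.
by rewrite lerXn2r// nnegrE (le_trans t0).
Qed.

End LeastSquares.

Theorem theorem2p5 (R : realType) (r : R) (n : nat)
    (A : 'I_n -> R * R) (P : 'I_n -> R)
    (hr : 0 < r) (hn : n = 1%N \/ n = 2%N)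
    (hA : forall i, coin_game (A i)) (hbasis : cone_basis A)
    (hP : forall i, 0 < P i)
    (hle : forall i, P i <= lsq_price r A i)
    (hlt : exists k, P k < lsq_price r A k) :
  exists q : 'I_n -> R,
    [/\ forall i, 0 <= q i,
        mixed_game A q != 0 &
        expR r < growth_rate (mixed_game A q) (\sum_(i < n) q i * P i)].
Proof.
have [p pS lt_p] := lsq_price_minimal r A P hr hA hle hlt.
have gM := coin_game_mixed A p hA pS.
exists p; split; first exact: pS.2.
  by apply/eqP => M0; case: gM; rewrite M0 ltxx.
(* Growth at most [e^r] would make the cost of the mixture at least its price, contrary to
   [lt_p]. *)
rewrite ltNge; apply/negP => /(price_le _ _ _ hr gM (simplex_sum_gt0 _ _ pS hP)).
by rewrite leNgt lt_p.
Qed.
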